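(* Let $n\in\mathbb{N}$, $P\subseteq[n]\times[n]$, and $V=\{\sum_{(i,j)\in P}\omega_{ij}E_{ij}:\omega_{ij}\ge 0\}\subseteq M_n(\mathbb{R})$. Let $\psi:V\to\mathbb{R}$ be a convex and positively homogeneous function. Suppose that $f:V\to\mathbb{R}$ is one of the following functions: (i) a concave and positively homogeneous function; (ii) for given real numbers $\alpha_i$ ($1\le i\le n^2$), $f(A)=\sum_{1\le i\le n^2}\alpha_i A_{\downarrow i}$; (iii) for given real numbers $\alpha_{ij}$ ($i,j\in[n]$), $f(A)=\sum_{j\in[n]}\sum_{i\in[n]}\alpha_{ij}\,\boldsymbol{r}^{i}_{\downarrow j}$, where $\boldsymbol{r}^{i}$ is the $i$-th row of $A$. Then the following statements are equivalent: (1) For every $A\in V$, $\psi(A)\le f(A)$. (2) For every $A\in V_{\{0,1\}}$, $\psi(A)\le f(A)$.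
   Context: $[n]=\{1,\ldots,n\}$. $M_n(\mathbb{R})$ is the set of real $n\times n$ matrices and $E_{ij}=\boldsymbol{e}_i\boldsymbol{e}_j^T$ is the $n\times n$ matrix with a $1$ in position $(i,j)$ and $0$ elsewhere. For a vector $\boldsymbol{x}\in\mathbb{R}^n$, $\boldsymbol{x}_{\downarrow1}\ge\cdots\ge\boldsymbol{x}_{\downarrow n}$ are its coordinates in decreasing order. For an $n\times n$ matrix $A$, $A_{\downarrow1}\ge\cdots\ge A_{\downarrow n^2}$ are all $n^2$ entries of $A$ in decreasing order. A function $g$ is positively homogeneous if $g(\alpha v)=\alpha g(v)$ for all real $\alpha>0$ and all $v$ in its domain. $V_{\{0,1\}}$ is the set of matrices in $V$ all of whose entries lie in $\{0,1\}$. *)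

(* Defs.v *)
From mathcomp Require Import all_boot all_order all_algebra.
From mathcomp Require Import boolp classical_sets reals convex.

Set Implicit Arguments.
Unset Strict Implicit.
Unset Printing Implicit Defensive.

Import Order.TTheory GRing.Theory Num.Theory.

Local Open Scope classical_set_scope.
Local Open Scope ring_scope.

(* [n] is rendered as 'I_n, so all indices start at 0.  A real-valued function
   on V is rendered as a total function on 'M[R]_n, of which only the values
   on V are ever constrained or used. *)

Section Defs.
Variables (R : realType) (n : nat).

Definition patternCone (P : {set 'I_n * 'I_n}) : set 'M[R]_n :=
  [set A | exists2 w : 'I_n -> 'I_n -> R,
     (forall i j, (i, j) \in P -> 0 <= w i j)
     & A = \sum_(p in P) w p.1 p.2 *: delta_mx p.1 p.2].

Definition zeroOne (V : set 'M[R]_n) : set 'M[R]_n :=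
  [set A | V A /\ forall i j, A i j = 0 \/ A i j = 1].

Definition concave_function (V : set 'M[R]_n) (g : 'M[R]_n -> R) : Prop :=
  convex_function V (fun A => - g A).

Definition pos_homogeneous (V : set 'M[R]_n) (g : 'M[R]_n -> R) : Prop :=
  forall (a : R) (A : 'M[R]_n), 0 < a -> V A -> g (a *: A) = a * g A.

End Defs.

(* The k-th largest coordinate of x, counted with multiplicity from k = 0. *)
Definition decr (R : realType) (m : nat) (x : 'rV[R]_m) (k : 'I_m) : R :=
  (sort >=%R [seq x 0 j | j <- enum 'I_m])`_k.

(* mxvec A lists the n * n entries of A as a row vector. *)
Definition decr_mx (R : realType) (n : nat) (A : 'M[R]_n) (k : 'I_(n * n)) : R :=
  decr (mxvec A) k.

(* Main.v *)
Require Import Defs.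
From mathcomp Require Import all_boot all_order all_algebra.
From mathcomp Require Import boolp classical_sets reals convex.
From mathcomp Require Import interval_inference lra.

(** Peel the nonnegative matrix A one layer at a time: if m is its smallest
    nonzero entry, then A = m S + B, where S is the 0/1 indicator of the support
    of A and B >= 0 has a smaller support. The entries of S and B are
    nondecreasing functions of the entries of A, so one ordering of the
    coordinates sorts all three matrices; hence functions of type (ii) and (iii)
    satisfy f A = m f S + f B. Functions of type (i) are superadditive and satisfy
    m f S + f B <= f A, while psi A <= m psi S + psi B, and induction on the size
    of the support concludes. *)

Set Implicit Arguments.
Unset Strict Implicit.
Unset Printing Implicit Defensive.

Import Order.TTheory GRing.Theory Num.Theory.

Local Open Scope classical_set_scope.
Local Open Scope ring_scope.

(** Both sides are decreasing, the right one because [phi] is monotone, and they are permutations of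
    each other; antisymmetry of the order then makes them equal. *)
Lemma sort_ge_map (R : realType) (phi : R -> R) (s : seq R) :
  {homo phi : x y / x <= y} ->
  sort >=%R (map phi s) = map phi (sort >=%R s).
Proof.
move=> phi_homo; apply: (@sorted_eq _ >=%R).
- by move=> y x z xy yz; apply: le_trans yz xy.
- by move=> x y; rewrite andbC; exact: le_anti.
- by apply: sort_sorted => x y; exact: le_total.
- apply: (homo_sorted (e := >=%R)) => [x y|]; first exact: phi_homo.
  by apply: sort_sorted => x y; exact: le_total.
- by rewrite perm_sort perm_map // perm_sym perm_sort.
Qed.

Lemma decr_map (R : realType) (m : nat) (phi : R -> R) (x : 'rV[R]_m)
    (k : 'I_m) :
  {homo phi : s t / s <= t} -> decr (map_mx phi x) k = phi (decr x k).
Proof.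
move=> phi_homo; rewrite /decr.
have -> : [seq map_mx phi x 0 j | j <- enum 'I_m] =
          map phi [seq x 0 j | j <- enum 'I_m].
  by rewrite -map_comp; apply: eq_map => j /=; rewrite mxE.
by rewrite sort_ge_map // (nth_map 0) // size_sort size_map size_enum_ord.
Qed.

(** Transfers to the sorted coordinates any property shared by all entries, such as being 0 or at
    least [m]. *)
Lemma decr_entry (R : realType) (m : nat) (x : 'rV[R]_m) (k : 'I_m) :
  exists j, decr x k = x 0 j.
Proof.
have : decr x k \in [seq x 0 j | j <- enum 'I_m].
  by rewrite -(mem_sort >=%R) mem_nth // size_sort size_map size_enum_ord.
by move=> /mapP[j _ ->]; exists j.
Qed.

Definition support_ind (R : realType) (t : R) : R := (0 < t)%R%:R.

(** For [m > 0] and [t] either 0 or at least [m], this is [t - m * support_ind t]. That difference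
    drops just after 0, whereas the truncated form is monotone on the whole line, as [decr_map]
    requires. *)
Definition residue (R : realType) (m t : R) : R := Num.max (t - m) 0.

Lemma support_ind_homo (R : realType) :
  {homo @support_ind R : s t / s <= t}.
Proof.
move=> s t st; rewrite /support_ind ler_nat.
by case: (ltP 0 s) => // s_gt0; rewrite (lt_le_trans s_gt0 st).
Qed.

Lemma residue_homo (R : realType) (m : R) :
  {homo residue m : s t / s <= t}.
Proof. by move=> s t st; rewrite /residue le_max2 // lerB. Qed.

Lemma layer_split (R : realType) (m t : R) :
  0 < m -> t = 0 \/ m <= t -> t = m * support_ind t + residue m t.
Proof.
rewrite /support_ind /residue => m_gt0 [->|mt].
  by rewrite ltxx mulr0 add0r sub0r max_r // oppr_le0 ltW.
by rewrite (lt_le_trans m_gt0 mt) mulr1 max_l ?subr_ge0 // addrC subrK.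
Qed.

Lemma layer_split_mx (R : realType) (p q : nat) (m : R) (A : 'M[R]_(p, q)) :
  0 < m -> (forall i j, A i j = 0 \/ m <= A i j) ->
  A = m *: map_mx (@support_ind R) A + map_mx (residue m) A.
Proof.
by move=> m_gt0 Am; apply/matrixP => i j; rewrite !mxE; exact: layer_split.
Qed.

(** Monotone maps commute with [decr], so the claim reduces to the scalar splitting of the single
    number [decr x k]. *)
Lemma decr_layer (R : realType) (p : nat) (m : R) (x : 'rV[R]_p) (k : 'I_p) :
  0 < m -> (forall j, x 0 j = 0 \/ m <= x 0 j) ->
  decr x k =
    m * decr (map_mx (@support_ind R) x) k + decr (map_mx (residue m) x) k.
Proof.
move=> m_gt0 xm.
rewrite (decr_map _ _ (@support_ind_homo R)) (decr_map _ _ (@residue_homo R m)).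
by apply: layer_split => //; have [j ->] := decr_entry x k; exact: xm.
Qed.

(** Distinct matrix units have disjoint supports, so the weights on [P] are just the entries of the
    matrix. *)
Lemma patternConeP (R : realType) (n : nat) (P : {set 'I_n * 'I_n})
    (A : 'M[R]_n) :
  patternCone P A <->
  (forall i j, 0 <= A i j) /\ (forall i j, (i, j) \notin P -> A i j = 0).
Proof.
have sumE (w : 'I_n -> 'I_n -> R) i j :
    (\sum_(p in P) w p.1 p.2 *: delta_mx p.1 p.2 : 'M[R]_n) i j =
    if (i, j) \in P then w i j else 0.
  rewrite summxE; case: ifP => [ijP|/negbT ijP].
    rewrite (bigD1 (i, j)) //= big1 ?addr0 ?mxE ?eqxx ?mulr1 // => -[k l] /=.
    by case/andP=> _; rewrite xpair_eqE !mxE eq_sym (eq_sym l) => /negbTE->;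
      rewrite mulr0.
  apply: big1 => -[k l] /= klP; rewrite !mxE; case: eqVneq => [ik|]; last first.
    by rewrite mulr0.
  by case: eqVneq => [jl|]; [rewrite ik jl klP in ijP|rewrite mulr0].
split=> [[w w_ge0 ->]|[A_ge0 A0]].
  split=> i j; rewrite sumE; last by move/negbTE->.
  by case: ifP => // /w_ge0.
exists (fun i j => A i j) => //; apply/matrixP => i j; rewrite sumE.
by case: ifPn => // /A0.
Qed.

Section PatternCone.
Variables (R : realType) (n : nat) (P : {set 'I_n * 'I_n}).
Let V := @patternCone R n P.

Lemma patternCone_scale (a : R) (A : 'M[R]_n) : 0 <= a -> V A -> V (a *: A).
Proof.
move=> a_ge0 /patternConeP[A_ge0 A0]; apply/patternConeP.
by split=> i j; rewrite mxE; [rewrite mulr_ge0|move/A0->; rewrite mulr0].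
Qed.

Lemma patternCone_map (phi : R -> R) (A : 'M[R]_n) :
  phi 0 = 0 -> (forall t, 0 <= phi t) -> V A -> V (map_mx phi A).
Proof.
move=> phi0 phi_ge0 /patternConeP[_ A0]; apply/patternConeP.
by split=> i j; rewrite mxE // => /A0->.
Qed.

Lemma patternCone_support (A : 'M[R]_n) :
  V A -> zeroOne V (map_mx (@support_ind R) A).
Proof.
move=> VA; split=> [|i j].
  by apply: patternCone_map VA => [|t]; rewrite /support_ind ?ltxx ?ler0n.
by rewrite mxE /support_ind; case: ltP => _; [right|left].
Qed.

Lemma patternCone_residue (m : R) (A : 'M[R]_n) :
  0 <= m -> V A -> V (map_mx (residue m) A).
Proof.
move=> m_ge0; apply: patternCone_map => [|t]; rewrite /residue.
  by rewrite sub0r max_r // oppr_le0.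
by rewrite le_max lexx orbT.
Qed.

(** [A + B] is the midpoint of [2 *: A] and [2 *: B], and homogeneity turns each half of
    [g (2 *: _)] back into [g]. *)
Lemma convex_pos_homogeneous_subadditive (g : 'M[R]_n -> R) (A B : 'M[R]_n) :
  convex_function V g -> pos_homogeneous V g -> V A -> V B ->
  g (A + B) <= g A + g B.
Proof.
move=> g_conv g_hom VA VB.
have two_gt0 : 0 < 2 :> R by rewrite ltr0n.
have [t tE] : exists t : {i01 R}, t%:num = 2^-1.
  by exists (Itv01 (x := 2^-1) ltac:(lra) ltac:(lra)).
have := g_conv t (2 *: A) (2 *: B).
rewrite !inE => /(_ (patternCone_scale (ltW two_gt0) VA)).
move=> /(_ (patternCone_scale (ltW two_gt0) VB)).
have -> : conv t (2 *: A : convex_lmodType 'M[R]_n) (2 *: B) = A + B.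
  rewrite [LHS]/(t%:num *: (2 *: A) + (1 - t%:num) *: (2 *: B)) tE !scalerA.
  rewrite (_ : (1 - 2^-1) * 2 = 1); last by lra.
  by rewrite mulVf ?pnatr_eq0 // !scale1r.
have -> : conv t (g (2 *: A) : R^o) (g (2 *: B)) =
          t%:num * g (2 *: A) + (1 - t%:num) * g (2 *: B) by [].
by rewrite !g_hom // tE => /le_trans; apply; lra.
Qed.

End PatternCone.

Section Layers.
Variables (R : realType) (n : nat) (P : {set 'I_n * 'I_n}).
Let V := @patternCone R n P.

(** The common property of the three kinds of [f] on which the induction rests. *)
Definition layer_superadditive (f : 'M[R]_n -> R) :=
  forall (m : R) (A : 'M[R]_n), 0 < m -> V A ->
    (forall i j, A i j = 0 \/ m <= A i j) ->
    m * f (map_mx (@support_ind R) A) + f (map_mx (residue m) A) <= f A.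

Lemma concave_layer_superadditive (f : 'M[R]_n -> R) :
  concave_function V f -> pos_homogeneous V f -> layer_superadditive f.
Proof.
move=> f_conc f_hom m A m_gt0 VA Am.
have [VS _] := patternCone_support VA.
have VB := patternCone_residue (ltW m_gt0) VA.
have Nf_hom : pos_homogeneous V (fun B => - f B).
  by move=> a B a_gt0 VB'; rewrite f_hom // mulrN.
have := convex_pos_homogeneous_subadditive f_conc Nf_hom
  (patternCone_scale (ltW m_gt0) VS) VB.
by rewrite -layer_split_mx // f_hom // -opprD lerN2.
Qed.

(** Equality holds for each rank [k] separately, so the signs of the coefficients [a k] do not
    matter. *)
Lemma decr_mx_layer_superadditive (f : 'M[R]_n -> R)
    (a : 'I_(n * n) -> R) :
  (forall A, V A -> f A = \sum_(k < n * n) a k * decr_mx A k) ->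
  layer_superadditive f.
Proof.
move=> fE m A m_gt0 VA Am.
have [VS _] := patternCone_support VA.
rewrite !fE //; last exact: patternCone_residue (ltW m_gt0) VA.
rewrite mulr_sumr -big_split /=; rewrite le_eqVlt; apply/predU1P; left; apply: eq_bigr => k _.
rewrite /decr_mx -!map_mxvec [in RHS](decr_layer (m := m)) // => [|l].
  by rewrite mulrDr mulrCA.
by case/mxvec_indexP: l => i j; rewrite mxvecE.
Qed.

(** Again an equality term by term: the one threshold [m] of the whole matrix is valid in every
    row. *)
Lemma decr_row_layer_superadditive (f : 'M[R]_n -> R)
    (a : 'I_n -> 'I_n -> R) :
  (forall A, V A ->
     f A = \sum_(j < n) \sum_(i < n) a i j * decr (row i A) j) ->
  layer_superadditive f.
Proof.
move=> fE m A m_gt0 VA Am.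
have [VS _] := patternCone_support VA.
rewrite !fE //; last exact: patternCone_residue (ltW m_gt0) VA.
rewrite mulr_sumr -big_split /=; rewrite le_eqVlt; apply/predU1P; left; apply: eq_bigr => j _.
rewrite mulr_sumr -big_split /=; apply: eq_bigr => i _.
rewrite -!map_row [in RHS](decr_layer (m := m)) // => [|l].
  by rewrite mulrDr mulrCA.
by rewrite mxE.
Qed.

Lemma le_of_zeroOne (psi f : 'M[R]_n -> R) :
  convex_function V psi -> pos_homogeneous V psi -> layer_superadditive f ->
  (forall A, zeroOne V A -> psi A <= f A) -> forall A, V A -> psi A <= f A.
Proof.
move=> psi_conv psi_hom f_layer le01 A.
have [s] := ubnP #|[set p | A p.1 p.2 != 0]|%SET.
elim: s A => // s IHs A; rewrite ltnS => card_supp VA.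
have /patternConeP[A_ge0 _] := VA.
have [p0 p0_supp|A0] := pickP (fun p => A p.1 p.2 != 0); last first.
  (* With empty support [A] is zero, hence itself a 0/1 matrix. *)
  apply: le01; split=> // i j; left; apply/eqP.
  by have /negbFE := A0 (i, j).
(* A position of the smallest nonzero entry; [p0] witnesses that there is one. *)
pose p := [arg min_(q < p0 | A q.1 q.2 != 0) A q.1 q.2]%O.
have [p_supp p_min] : A p.1 p.2 != 0 /\
    forall q, A q.1 q.2 != 0 -> A p.1 p.2 <= A q.1 q.2.
  by rewrite /p; case: arg_minP.
set m := A p.1 p.2 in p_supp p_min.
have m_gt0 : 0 < m by rewrite lt_def p_supp A_ge0.
have Am i j : A i j = 0 \/ m <= A i j.
  by have [|/(p_min (i, j))] := eqVneq (A i j) 0; [left|right].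
have S01 := patternCone_support VA; have [VS _] := S01.
have VB := patternCone_residue (ltW m_gt0) VA.
apply: le_trans (f_layer m A m_gt0 VA Am).
rewrite [in leLHS](layer_split_mx m_gt0 Am).
apply: le_trans (convex_pos_homogeneous_subadditive psi_conv psi_hom
  (patternCone_scale (ltW m_gt0) VS) VB) _.
rewrite psi_hom // lerD // ?ler_pM2l //; first exact: le01 S01.
(* The support shrinks strictly: zero entries stay zero, and the entry at [p], equal to [m], becomes
   zero. *)
apply: IHs VB; apply: leq_trans card_supp; apply/proper_card/properP; split.
  apply/fintype.subsetP=> q; rewrite !inE mxE; apply: contraNN => /eqP->.
  by rewrite /residue sub0r max_r // oppr_le0 ltW.
by exists p; rewrite !inE // mxE /residue -/m subrr maxxx eqxx.
Qed.

End Layers.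

Theorem theorem2p6 (R : realType) (n : nat) (P : {set 'I_n * 'I_n})
    (V := @patternCone R n P) (psi f : 'M[R]_n -> R)
    (psi_convex : convex_function V psi)
    (psi_hom : pos_homogeneous V psi)
    (f_cases :
      [\/ concave_function V f /\ pos_homogeneous V f,
          exists a : 'I_(n * n) -> R, forall A, V A ->
            f A = \sum_(k < n * n) a k * decr_mx A k
        | exists a : 'I_n -> 'I_n -> R, forall A, V A ->
            f A = \sum_(j < n) \sum_(i < n) a i j * decr (row i A) j]) :
  (forall A, V A -> psi A <= f A)
  <-> (forall A, zeroOne V A -> psi A <= f A).
Proof.
split=> [le_V A [VA _]|]; first exact: le_V.
apply: le_of_zeroOne => //.
case: f_cases => [[]|[a]|[a]].
- exact: concave_layer_superadditive.
- exact: decr_mx_layer_superadditive.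
- exact: decr_row_layer_superadditive.
Qed.
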